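(* For every $n\ge 3$ with $n\ne 4$ there is a tight irreducible subcube partition of $\{0,1\}^n$ of size $5\cdot 2^{n-3}$.
   Context: A subcube partition of length $n$ is a partition of $\{0,1\}^n$ into subcubes (words in $\{0,1,*\}^n$); its size is the number of subcubes. It is irreducible if no subset $G$ with $1<|G|<|F|$ has a union that is a subcube; tight if for every coordinate $i$ some subcube $s$ has $s_i\ne *$. *)

(* Defs.v *)
From mathcomp Require Import all_boot.

Set Implicit Arguments.
Unset Strict Implicit.
Unset Printing Implicit Defensive.

Definition point (n : nat) : finType := {ffun 'I_n -> bool}.

(* A word in {0,1,*}^n: [Some b] is the fixed bit b, [None] is the star. *)
Definition word (n : nat) : finType := {ffun 'I_n -> option bool}.

Definition subcube (n : nat) (w : word n) : {set point n} :=
  [set x : point n | [forall i, (w i == None) || (w i == Some (x i))]].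

(* Distinct words denote distinct subcubes, so a set of words is the same thing
   as a set of subcubes and #|F| is the number of subcubes. *)
Lemma subcube_inj (n : nat) : injective (@subcube n).
Proof.
have agree (v w : word n) i b :
  subcube v = subcube w -> w i = Some b -> v i = Some b.
  move=> e wi.
  pose x c : point n := [ffun j => odflt c (v j)].
  have key c : odflt c (v i) = b.
    have: x c \in subcube v.
      by rewrite inE; apply/forallP => j; rewrite ffunE; case: (v j) => //= a; rewrite eqxx.
    rewrite e inE => /forallP/(_ i).
    by rewrite wi ffunE /= => /eqP[].
  by move: (key (~~ b)); case: (v i) => [c /= -> //|/=]; case: (b).
move=> v w e; apply/ffunP => i.
case wi: (w i) => [b|]; first exact: agree e wi.
by case vi: (v i) => [b|//]; rewrite (agree _ _ _ _ (esym e) vi) in wi.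
Qed.

Definition subcube_partition (n : nat) (F : {set word n}) : Prop :=
  partition [set subcube s | s in F] [set: point n].

Definition irreducible (n : nat) (F : {set word n}) : Prop :=
  forall G : {set word n}, G \subset F -> 1 < #|G| < #|F| ->
  ~ exists w : word n, \bigcup_(s in G) subcube s = subcube w.

Definition tight (n : nat) (F : {set word n}) : Prop :=
  forall i : 'I_n, exists2 s : word n, s \in F & s i <> None.

(* Main.v *)
Require Import Defs.
From mathcomp Require Import all_boot zify.

Set Implicit Arguments.
Unset Strict Implicit.
Unset Printing Implicit Defensive.

(** A matching of the hypercube graph yields a partition of {0,1}^n into edges
and points.  A union of blocks that is a subcube is a subcube left by no matching
edge, so the partition is irreducible as soon as every proper subcube that is not
a block is left by some matching edge.  Its size is (2^n + u)/2 with u the number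
of unmatched points, so we need u = 2^(n-2); here the unmatched points are cut out
by two independent linear equations.

For n = 3 match three edges so as to leave two antipodal points.  For n >= 5 write
a word as (p, z) with p of length 5.  Over each z put a fixed matching of {0,1}^5,
translated by 11010 when z has odd parity.  The two translates share neither an
edge nor an unmatched point, so only subcubes {0,1}^5 x v are left by no edge.
To break these, z is joined to two neighbours z': an alternating 8-cycle,
consisting of two matching edges over z, two over z' and the two vertical edges
at a pair of points p, is switched.  The neighbours are obtained by flipping the
first bit of z, and by flipping the bit that follows the first 1 of z (the last bit
if all earlier bits vanish): the two steps of the binary Gray code, so no proper v
is closed under both.  Finally, parallel vertical edges must not form a larger
subcube; for this the position of each 8-cycle depends on the parity of the bits
of z other than the flipped one. *)

(** * Finite checks on {0,1}^5 *)

Fixpoint points_of (u : seq (option bool)) : seq (seq bool) :=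
  match u with
  | [::] => [:: [::]]
  | Some a :: v => map (cons a) (points_of v)
  | None :: v => map (cons false) (points_of v) ++ map (cons true) (points_of v)
  end.

Fixpoint words (k : nat) : seq (seq (option bool)) :=
  if k is k'.+1 then
    [seq a :: v | a <- [:: None; Some false; Some true], v <- words k']
  else [:: [::]].

Definition toggle (k : nat) (p : seq bool) : seq bool :=
  mkseq (fun i => nth false p i (+) (i == k)) (size p).

Definition index_of (p : seq bool) : nat := foldr (fun (b : bool) m => b + m.*2) 0 p.

(* A local code is the direction in which a point of {0,1}^5 is matched: [0] to [4]
   inside {0,1}^5, [5] along the first bit of z, [6] along the Gray-code bit of z,
   and [7] for an unmatched point.  The table was found by computer search. *)
Definition base_code : seq nat :=
  [:: 7; 4; 0; 0; 1; 3; 1; 7; 1; 7; 1; 2; 4; 3; 7; 2;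
      3; 4; 2; 7; 7; 1; 2; 1; 3; 1; 7; 1; 4; 7; 0; 0].

(* The points [p, a, b, p'] of the switched 8-cycle over one z, numbered as by
   [index_of]: the matching edges [pa] and [bp'] become [ab] and vertical edges at
   [p] and [p'].  Translation by [11] = 1 + 2 + 8 exchanges the roles of the paths
   [A] and [B]: the first-bit cycle follows [A] over even z and [B] over odd z,
   the Gray-code cycle conversely. *)
Definition path_A (q : bool) := if q then [:: 4; 6; 22; 18] else [:: 1; 17; 21; 23].
Definition path_B (q : bool) := if q then [:: 15; 11; 27; 25] else [:: 10; 8; 12; 28].

(** The edge [ab] has direction 4 in the paths selected by [q = true] and 2 in the others. Off the
    path [index] is 4, so [nth] returns [old]. *)
Definition reroute (q : bool) (c : nat) (path : seq nat) (i old : nat) : nat :=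
  let mid := if q then 4 else 2 in nth old [:: c; mid; mid; c] (index i path).

(* [e] is the number of 8-cycles through z (fewer than two only for n = 5, 6), [b] the
   parity of z, and [s], [g] select the positions of the two cycles. *)
Definition code (e : nat) (b s g : bool) (p : seq bool) : nat :=
  let i := index_of (if b then toggle 0 (toggle 1 (toggle 3 p)) else p) in
  let c := nth 7 base_code i in
  let c := if 1 < e then reroute g 6 (if b then path_A g else path_B g) i c else c in
  if 0 < e then reroute s 5 (if b then path_B s else path_A s) i c else c.

(** Codes from [m] on are skipped: they stand for vertical edges, treated through [hits], and for
    unmatched points. *)
Definition closed_in (m : nat) (cd : seq bool -> nat) (u : seq (option bool)) : bool :=
  all (fun p => if cd p < m then nth None u (cd p) == None else true) (points_of u).

Definition hits (k : nat) (cd : seq bool -> nat) (u : seq (option bool)) : bool :=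
  has (fun p => cd p == k) (points_of u).

Definition single_block (m : nat) (cd : seq bool -> nat) (u : seq (option bool)) : bool :=
  has (fun p => u == mkseq (fun i => if i == cd p then None else Some (nth false p i)) m)
      (points_of u).

Definition full (u : seq (option bool)) : bool := all (pred1 None) u.

Definition bools := [:: false; true].

Lemma mem_bools (b : bool) : b \in bools.
Proof. by case: b. Qed.

(* If [u] contains an end of a vertical edge, then a closed subcube over [u] also
   contains the neighbouring z, so [u] must be closed there as well; the first-bit
   neighbour has the same [s] but an unknown [g']. *)
Definition viable (e : nat) (b s g : bool) (u : seq (option bool)) : bool :=
  [&& closed_in 5 (code e b s g) u,
      (hits 5 (code e b s g) u) ==> has (fun g' => closed_in 5 (code e (~~ b) s g') u) bools
    & (hits 6 (code e b s g) u) ==> closed_in 5 (code e (~~ b) (~~ s) g) u].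

(** Meant for an even and an odd layer, not necessarily adjacent, of one closed word. Outside the
    full case the equality [s == s'] or [g == g'] is what later leaves z a single free letter. *)
Lemma pair_check :
  all (fun e => all (fun s => all (fun g =>
   all (fun u => all (fun s' => all (fun g' =>
    viable e true s' g' u ==>
    [|| full u,
      [&& all isSome u, s == s', all (fun p => code e false s g p == 5) (points_of u)
        & all (fun p => code e true s' g' p == 5) (points_of u)]
     | [&& all isSome u, g == g', all (fun p => code e false s g p == 6) (points_of u)
        & all (fun p => code e true s' g' p == 6) (points_of u)]])
    bools) bools)
   (filter (viable e false s g) (words 5))) bools) bools) [:: 1; 2].
Proof. by vm_compute. Qed.

(** Meant for words with z fixed: a vertical edge met by [u] would free a letter of z, so only the
    whole cube for n = 5 and blocks survive. *)
Lemma single_check :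
  all (fun e => all (fun b => all (fun s => all (fun g =>
   all (fun u =>
    [|| hits 5 (code e b s g) u && (0 < e), hits 6 (code e b s g) u && (1 < e),
        full u && (e == 0) | single_block 5 (code e b s g) u])
   (filter (closed_in 5 (code e b s g)) (words 5))) bools) bools) bools) [:: 0; 1; 2].
Proof. by vm_compute. Qed.

Lemma full_check :
  all (fun e => all (fun b => all (fun s => all (fun g =>
    hits 5 (code e b s g) (nseq 5 None) && ((1 < e) ==> hits 6 (code e b s g) (nseq 5 None)))
   bools) bools) bools) [:: 1; 2].
Proof. by vm_compute. Qed.

(** Makes the matching symmetric. The first-bit step may change [g] arbitrarily, hence the test over
    all [g']; the Gray-code step negates [b] and [s] and keeps [g]. *)
Lemma involution_check :
  all (fun e => all (fun b => all (fun s => all (fun g => all (fun p =>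
    let c := code e b s g p in
    [|| (c < 5) && (code e b s g (toggle c p) == c),
        [&& c == 5, 0 < e & all (fun g' => code e (~~ b) s g' p == 5) bools],
        [&& c == 6, 1 < e & code e (~~ b) (~~ s) g p == 6] | c == 7])
   (points_of (nseq 5 None))) bools) bools) bools) [:: 0; 1; 2].
Proof. by vm_compute. Qed.

(** Switching a cycle keeps its points matched, so only the translation matters: toggling bits 0, 1,
    3 preserves the first equation and negates the second, hence the summand [b]. *)
Lemma unmatched_check :
  all (fun e => all (fun b => all (fun s => all (fun g => all (fun p =>
    let c := code e b s g p in let x := nth false p in
    (c == 7) == ~~ (x 0 (+) x 2 (+) x 3 (+) x 4) && ~~ (x 1 (+) x 2 (+) x 4 (+) b))
   (points_of (nseq 5 None))) bools) bools) bools) [:: 0; 1; 2].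
Proof. by vm_compute. Qed.

(** * Partitions from matchings *)

Definition flip (n : nat) (x : point n) (k : nat) : point n :=
  [ffun j : 'I_n => x j (+) (j == k :> nat)].

Lemma flipK (n : nat) (k : nat) : involutive (fun x : point n => flip x k).
Proof. by move=> x; apply/ffunP => j; rewrite !ffunE addbK. Qed.

Lemma mem_subcube (n : nat) (w : word n) (x : point n) :
  reflect (forall i, w i = None \/ w i = Some (x i)) (x \in subcube w).
Proof.
rewrite inE; apply: (iffP forallP) => h i.
  by have /orP[/eqP|/eqP] := h i; [left | right].
by case: (h i) => ->; rewrite ?eqxx ?orbT.
Qed.

Lemma flip_in_subcube (n : nat) (w : word n) (x : point n) (i : 'I_n) :
  x \in subcube w -> (flip x i \in subcube w) = (w i == None).
Proof.
move=> /mem_subcube xw; apply/idP/idP => [/mem_subcube/(_ i)|/eqP wi].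
  by case: (xw i) => -> // [] // []; rewrite ffunE eqxx addbT; case: (x i).
apply/mem_subcube => j; have [->|ji] := eqVneq j i; first by left.
by rewrite ffunE val_eqE (negbTE ji) addbF.
Qed.

Lemma subcube_nonempty (n : nat) (w : word n) : exists x, x \in subcube w.
Proof.
exists [ffun j => odflt false (w j)]; apply/mem_subcube => j; rewrite ffunE.
by case: (w j) => [b|]; [right | left].
Qed.

Section Matching.

Variables (n : nat) (mu : point n -> option 'I_n).
Hypothesis muK : forall x i, mu x = Some i -> mu (flip x i) = Some i.

Definition block (x : point n) : word n :=
  [ffun j => if mu x == Some j then None else Some (x j)].

Definition blocks : {set word n} := [set block x | x : point n].

Lemma mem_block x y :
  (y \in subcube (block x)) =
  (y == x) || (if mu x is Some i then y == flip x i else false).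
Proof.
apply/mem_subcube/idP => [h|/orP[/eqP->|]].
- case ex: (mu x) => [i|]; last first.
    rewrite orbF; apply/eqP/ffunP => j.
    by have := h j; rewrite ffunE ex /= => -[] // [].
  have yj j : j != i -> y j = x j.
    by have := h j; rewrite ffunE ex (inj_eq Some_inj) eq_sym; case: eqP => // _ [] // [].
  have [yi|yi] := eqVneq (y i) (x i); [apply/orP; left|apply/orP; right].
    by apply/eqP/ffunP => j; have [->|/yj] := eqVneq j i.
  apply/eqP/ffunP => j; rewrite ffunE val_eqE.
  have [->|/yj->] := eqVneq j i; last by rewrite addbF.
  by rewrite addbT; move: yi; case: (y i); case: (x i).
- by move=> j; rewrite ffunE; case: ifP; [left | right].
- case ex: (mu x) => [i|] // /eqP-> j; rewrite !ffunE ex (inj_eq Some_inj) val_eqE eq_sym.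
  by case: eqP => _; [left | right; rewrite addbF].
Qed.

Lemma block_id x : x \in subcube (block x).
Proof. by rewrite mem_block eqxx. Qed.

Lemma block_eq x y : y \in subcube (block x) -> block y = block x.
Proof.
rewrite mem_block; case ex: (mu x) => [i|]; last by rewrite orbF => /eqP->.
case/orP => /eqP-> //; apply/ffunP => j; rewrite !ffunE (muK ex) ex (inj_eq Some_inj).
by rewrite val_eqE eq_sym; case: eqP; rewrite ?addbF.
Qed.

Lemma blocks_partition : subcube_partition blocks.
Proof.
apply/and3P; split.
- apply/eqP/setP => x; rewrite inE; apply/bigcupP.
  exists (subcube (block x)); last exact: block_id.
  by apply/imset_f/imset_f.
- apply/trivIsetP => _ _ /imsetP[_ /imsetP[x _ ->] ->] /imsetP[_ /imsetP[y _ ->] ->].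
  apply: contraR => /pred0Pn[z /= /andP[zx zy]].
  by rewrite -(block_eq zx) -(block_eq zy).
- apply/negP => /imsetP[_ /imsetP[x _ ->]] /setP/(_ x).
  by rewrite block_id inE.
Qed.

(** Give weight 1 to matched and 2 to unmatched points: every block then has total weight 2. *)
Lemma card_blocks : 2 * #|blocks| = 2 ^ n + #|[set x | mu x == None]|.
Proof.
pose weight x := 1 + (mu x == None).
have -> : 2 ^ n + #|[set x | mu x == None]| = \sum_(x in [set: point n]) weight x.
  rewrite big_split /= sum1_card cardsT card_ffun card_bool card_ord; congr (_ + _).
  rewrite -sum1_card big_mkcond [RHS]big_mkcond; apply: eq_bigr => x _.
  by rewrite !inE; case: eqP.
rewrite (set_partition_big _ blocks_partition) big_imset /=; last by move=> ? ? _ _; apply: subcube_inj.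
rewrite mulnC -sum_nat_const; apply: eq_bigr => _ /imsetP[x _ ->].
case ex: (mu x) => [i|]; last first.
  by rewrite (big_pred1 x) ?/weight ?ex // => y; rewrite mem_block ex orbF.
have xi : flip x i != x.
  by apply/eqP => /ffunP/(_ i); rewrite ffunE eqxx addbT; case: (x i).
rewrite (bigD1 x) ?block_id //= (big_pred1 (flip x i)) /weight ?ex ?(muK ex) // => y.
by rewrite mem_block ex /=; case: eqP => [->|_]; rewrite ?andbF ?andbT //= eq_sym (negbTE xi).
Qed.

Definition mu_closed (w : word n) : Prop :=
  forall x i, x \in subcube w -> mu x = Some i -> w i = None.

(** A union of blocks contains the mate of each of its points, so the word [w] of the union is
    closed. If [w] is full then [G] is everything; if [w] is a block then [G] has one member. *)
Lemma blocks_irreducible :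
  (forall w, mu_closed w -> (forall i, w i = None) \/ w \in blocks) ->
  irreducible blocks.
Proof.
move=> closedP G /subsetP GF /andP[G_gt1 G_ltF] [w Gw].
have Gblock x s : s \in G -> x \in subcube s -> s = block x.
  by move=> /GF/imsetP[y _ ->] /block_eq->.
have inG x : (x \in subcube w) = (block x \in G).
  rewrite -Gw; apply/bigcupP/idP => [[s sG xs]|xG]; first by rewrite -(Gblock x s).
  by exists (block x); rewrite ?block_id.
have [x i xw ex|wT|/imsetP[y _ wy]] := closedP w.
- apply/eqP; rewrite -(flip_in_subcube _ xw) inG (block_eq (x := x)) -?inG //.
  by rewrite mem_block ex eqxx orbT.
- move: G_ltF; rewrite ltnNge => /negP[]; apply/subset_leq_card/subsetP.
  by move=> _ /imsetP[x _ ->]; rewrite -inG; apply/mem_subcube => i; left.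
- move: G_gt1; rewrite ltnNge => /negP[]; rewrite -(cards1 w); apply/subset_leq_card/subsetP.
  move=> s sG; have /imsetP[x _ sx] := GF _ sG.
  by move: sG; rewrite sx -inG wy => /block_eq ->; rewrite inE.
Qed.

(** The flips at [i] and [j] permute the four classes given by the values of [c] and [d]
    transitively, so these have equal size. *)
Lemma card_quarter (c d : point n -> bool) (i j : nat) :
  (forall x, c (flip x i) = ~~ c x) -> (forall x, d (flip x i) = d x) ->
  (forall x, c (flip x j) = c x) -> (forall x, d (flip x j) = ~~ d x) ->
  4 * #|[set x | ~~ c x && ~~ d x]| = 2 ^ n.
Proof.
move=> ci di cj dj.
have shift k (P Q : point n -> bool) : (forall x, Q (flip x k) = P x) ->
    \sum_(x | P x) 1 = \sum_(x | Q x) 1.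
  move=> PQ; rewrite [RHS](reindex_inj (inv_inj (@flipK n k))).
  by apply: eq_bigl => x; rewrite PQ.
have -> : 2 ^ n = \sum_(x : point n) 1.
  by rewrite sum1_card card_ffun card_bool card_ord.
rewrite (bigID c) /= (bigID d) /= [X in _ + X](bigID d) /=.
rewrite -(shift i (fun x => ~~ c x && d x) (fun x => c x && d x)); last by move=> x; rewrite ci di.
rewrite -(shift i (fun x => ~~ c x && ~~ d x) (fun x => c x && ~~ d x)); last first.
  by move=> x; rewrite ci di.
rewrite -(shift j (fun x => ~~ c x && ~~ d x) (fun x => ~~ c x && d x)); last first.
  by move=> x; rewrite cj dj.
have -> : #|[set x | ~~ c x && ~~ d x]| = \sum_(x | ~~ c x && ~~ d x) 1.
  by rewrite -sum1_card; apply: eq_bigl => x; rewrite inE.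
by rewrite !mulSn addn0 !addnA.
Qed.

Lemma partition_of_matching (c d : point n -> bool) (i j : nat) :
  2 < n ->
  (forall w, mu_closed w -> (forall i, w i = None) \/ w \in blocks) ->
  (forall x, (mu x == None) = ~~ c x && ~~ d x) ->
  (forall x, c (flip x i) = ~~ c x) -> (forall x, d (flip x i) = d x) ->
  (forall x, c (flip x j) = c x) -> (forall x, d (flip x j) = ~~ d x) ->
  exists F : {set word n},
    [/\ subcube_partition F, tight F, irreducible F & #|F| = 5 * 2 ^ (n - 3)].
Proof.
move=> n_gt2 closedP U ci di cj dj; have := card_quarter ci di cj dj; have := card_blocks.
have -> : [set x | mu x == None] = [set x | ~~ c x && ~~ d x].
  by apply/setP => x; rewrite !inE U.
(* With q = [2 ^ (n - 3)] and u unmatched points, 2|F| = 8q + u and 4u = 8q, so |F| = 5q. *)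
have n3 : 2 ^ n = 8 * 2 ^ (n - 3) by rewrite -(expnD 2 3) subnKC.
rewrite n3 => cardF cardU; exists blocks; split; last by lia.
- exact: blocks_partition.
(* The block of an unmatched point has no star, so it alone witnesses tightness at every
   coordinate. *)
- have /card_gt0P[x] : 0 < #|[set x | ~~ c x && ~~ d x]|.
    by have := expn_gt0 2 (n - 3); lia.
  rewrite inE -U => /eqP mux k; exists (block x); first exact: imset_f.
  by rewrite ffunE mux.
- exact: blocks_irreducible.
Qed.

End Matching.

(** * Words as sequences of letters *)

Definition bit (n : nat) (x : point n) (k : nat) : bool := oapp x false (insub k).

(** The default is a fixed letter agreeing with the default of [bit]: a free letter is always in
    range, and membership can be tested at all naturals. *)
Definition letter (n : nat) (w : word n) (k : nat) : option bool :=
  oapp w (Some false) (insub k).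

Definition low (n m : nat) (x : point n) : seq bool := mkseq (bit x) m.

Definition low_word (n m : nat) (w : word n) : seq (option bool) := mkseq (letter w) m.

Definition put (n : nat) (p : seq bool) (x : point n) : point n :=
  [ffun j : 'I_n => if j < size p then nth false p j else x j].

Lemma mem_words (k : nat) (u : seq (option bool)) : size u = k -> u \in words k.
Proof.
elim: k u => [|k IHk] [] // a u [/IHk uk].
by apply/allpairsP; exists (a, u); split=> //; case: a => [[]|].
Qed.

Lemma points_ofP (u : seq (option bool)) (p : seq bool) :
  reflect (size p = size u /\ forall k, k < size u ->
             nth None u k = None \/ nth None u k = Some (nth false p k))
          (p \in points_of u).
Proof.
elim: u p => [|a u IHu] p /=.
  by rewrite inE; apply: (iffP eqP) => [->|[/size0nil]].
have cons_mem b v : (v \in map (cons b) (points_of u)) =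
    (if v is c :: q then (c == b) && (q \in points_of u) else false).
  case: v => [|c q]; first by apply/mapP => -[].
  apply/mapP/andP => [[r ru [-> ->]]|[/eqP-> qu]]; first by rewrite eqxx.
  by exists q.
have -> : (p \in match a with Some b => map (cons b) (points_of u)
      | None => map (cons false) (points_of u) ++ map (cons true) (points_of u) end) =
    (if p is c :: q then (if a is Some b then c == b else true) && (q \in points_of u) else false).
  case: a => [b|]; rewrite ?mem_cat !cons_mem; case: p => // c q.
  by case: c; rewrite ?orbF.
case: p => [|c q]; first by apply: ReflectF => -[].
apply: (iffP andP) => [[ca /IHu[sq qu]]|[[sq] qu]].
  split=> [|[_|k]] /=; rewrite ?sq //; last exact: qu.
  by case: a ca => [b /eqP->|_]; [right | left].
split; first by have := qu 0 isT; case: (a) => [b [] // [->]|].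
by apply/IHu; split=> // k; apply: qu k.+1.
Qed.

Section Bits.

Variable n : nat.
Implicit Types (x y : point n) (w : word n).

Lemma bit_ord x (i : 'I_n) : bit x i = x i.
Proof. by rewrite /bit valK. Qed.

Lemma letter_ord w (i : 'I_n) : letter w i = w i.
Proof. by rewrite /letter valK. Qed.

Lemma bit_out x k : n <= k -> bit x k = false.
Proof. by move=> nk; rewrite /bit insubF // ltnNge nk. Qed.

Lemma letter_lt w k : letter w k = None -> k < n.
Proof. by rewrite /letter; case: insubP. Qed.

Lemma mem_letters w x :
  reflect (forall k, letter w k = None \/ letter w k = Some (bit x k)) (x \in subcube w).
Proof.
apply: (iffP (mem_subcube w x)) => h k; last by rewrite -letter_ord -bit_ord.
by rewrite /letter /bit; case: insubP => [i _ _|_] /=; [apply: h | right].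
Qed.

Lemma bit_flip x k j : k < n -> bit (flip x k) j = bit x j (+) (j == k).
Proof.
move=> kn; have [nj|jn] := leqP n j.
  by rewrite !bit_out // gtn_eqF // (leq_trans kn).
by rewrite -[j]/(val (Ordinal jn)) !bit_ord ffunE.
Qed.

Lemma flip_letter w x k : x \in subcube w -> letter w k = None -> flip x k \in subcube w.
Proof.
move=> xw wk; have kn := letter_lt wk; rewrite -[k]/(val (Ordinal kn)) flip_in_subcube //.
by rewrite -letter_ord /= wk.
Qed.

Lemma bit_put p x k : size p <= n ->
  bit (put p x) k = if k < size p then nth false p k else bit x k.
Proof.
move=> pn; have [nk|kn] := leqP n k.
  by rewrite !bit_out // ltnNge (leq_trans pn nk).
by rewrite -[k]/(val (Ordinal kn)) !bit_ord ffunE.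
Qed.

Lemma low_in m w x : x \in subcube w -> low m x \in points_of (low_word m w).
Proof.
move=> /mem_letters xw; apply/points_ofP; rewrite !size_mkseq; split=> // k km.
by rewrite !nth_mkseq.
Qed.

Lemma put_in m w x p : m <= n -> x \in subcube w -> p \in points_of (low_word m w) ->
  [/\ put p x \in subcube w, low m (put p x) = p
    & forall k, m <= k -> bit (put p x) k = bit x k].
Proof.
move=> mn /mem_letters xw /points_ofP; rewrite size_mkseq => -[pm pw].
have pn : size p <= n by rewrite pm.
split.
- apply/mem_letters => k; rewrite bit_put // pm; case: ifP => km; last exact: xw.
  by have := pw k km; rewrite nth_mkseq.
- apply: (@eq_from_nth _ false); rewrite size_mkseq // => k km.
  by rewrite nth_mkseq // bit_put // pm km.
- by move=> k mk; rewrite bit_put // pm ltnNge mk.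
Qed.

Lemma low_word_full m w : (forall k, m <= k -> k < n -> letter w k = None) ->
  full (low_word m w) -> forall i, w i = None.
Proof.
move=> high /allP lo i; rewrite -letter_ord; have [|im] := leqP m i; first by move/high; apply.
by apply/eqP/lo; rewrite -(nth_mkseq None (letter w) im) mem_nth // size_mkseq.
Qed.

(** With every letter from [m] on fixed, [w] lies over one z, so the local block of [p] is the block
    of [put p x]. The hypothesis on [mu] concerns this layer only, where the single code [cd]
    governs. *)
Lemma block_of_single (mu : point n -> option 'I_n) m (cd : seq bool -> nat) w x :
  m <= n -> x \in subcube w -> (forall k, m <= k -> letter w k <> None) ->
  (forall y (i : 'I_n), y \in subcube w -> (forall k, m <= k -> bit y k = bit x k) ->
     (mu y == Some i) = (i < m) && (i == cd (low m y) :> nat)) ->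
  single_block m cd (low_word m w) -> w \in blocks mu.
Proof.
move=> mn xw high muE /hasP[p pu /eqP wp]; have [yw lowy bity] := put_in mn xw pu.
apply/imsetP; exists (put p x) => //; apply/ffunP => i; rewrite ffunE muE // lowy.
rewrite -letter_ord; case: ltnP => im /=.
  have := congr1 (fun u => nth None u i) wp; rewrite !nth_mkseq // => ->.
  by rewrite -[X in nth false X i]lowy nth_mkseq // bit_ord.
have /mem_letters/(_ i) := yw; rewrite bit_ord.
by case=> // /high; case.
Qed.

End Bits.

Lemma low_flip (n m k : nat) (x : point n) : k < n -> low m (flip x k) = toggle k (low m x).
Proof.
move=> kn; rewrite /toggle size_mkseq; apply/eq_in_map => i.
by rewrite mem_iota => im; rewrite bit_flip // nth_mkseq.
Qed.

Lemma low_flip_high (n m k : nat) (x : point n) : m <= k -> k < n -> low m (flip x k) = low m x.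
Proof.
move=> mk kn; apply/eq_in_map => i.
by rewrite mem_iota => im; rewrite bit_flip // ltn_eqF ?addbF // (leq_trans im).
Qed.

Lemma low_word_size (n m : nat) (w : word n) : low_word m w \in words m.
Proof. by apply: mem_words; rewrite size_mkseq. Qed.

Lemma low_points (n m : nat) (x : point n) : low m x \in points_of (nseq m None).
Proof.
apply/points_ofP; rewrite size_mkseq size_nseq; split=> // k km.
by left; rewrite nth_nseq km.
Qed.

Lemma all_at (T : eqType) (P : pred T) (s : seq T) (x : T) : all P s -> x \in s -> P x.
Proof. by move=> /allP; apply. Qed.

Lemma insub_eq_Some (n k : nat) (i : 'I_n) : (insub k == Some i) = (i == k :> nat).
Proof.
case: insubP => [j _ <-|nk] /=; first by rewrite (inj_eq Some_inj) eq_sym.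
by apply/esym/eqP => ik; move: nk; rewrite -ik ltn_ord.
Qed.

Lemma insub_eq_None (n k : nat) : ((insub k : option 'I_n) == None) = (n <= k).
Proof. by rewrite leqNgt; case: insubP => [j -> _|/negbTE ->]. Qed.

(** * Length three *)

(** The edges are 1-3, 2-6 and 4-5 in the numbering of [index_of]; 000 and 111 stay unmatched. *)
Definition code3 (p : seq bool) : nat := nth 7 [:: 7; 1; 2; 1; 0; 0; 2; 7] (index_of p).

Lemma code3_check :
  all (fun p => let c := code3 p in let x := nth false p in
    ((c < 3) ==> (code3 (toggle c p) == c)) &&
    ((3 <= c) == ~~ (x 0 (+) x 1) && ~~ (x 1 (+) x 2))) (points_of (nseq 3 None)).
Proof. by vm_compute. Qed.

Lemma code3_single_check :
  all (fun u => full u || single_block 3 code3 u) (filter (closed_in 3 code3) (words 3)).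
Proof. by vm_compute. Qed.

Lemma partition3 :
  exists F : {set word 3},
    [/\ subcube_partition F, tight F, irreducible F & #|F| = 5 * 2 ^ (3 - 3)].
Proof.
pose mu (x : point 3) : option 'I_3 := insub (code3 (low 3 x)).
have low_check (x : point 3) := allP code3_check _ (low_points 3 x).
have muK x i : mu x = Some i -> mu (flip x i) = Some i.
  move/eqP; rewrite insub_eq_Some => /eqP ci; apply/eqP; rewrite insub_eq_Some low_flip //.
  by have /andP[] := low_check x; rewrite -ci ltn_ord eq_sym.
(* Coordinate 0 occurs only in the first equation and coordinate 2 only in the second. *)
apply: (@partition_of_matching _ mu muK (fun x => bit x 0 (+) bit x 1)
  (fun x => bit x 1 (+) bit x 2) 0 2) => //.
- move=> w w_closed; have [x xw] := subcube_nonempty w.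
  have high k : 3 <= k -> letter w k <> None.
    by move=> k3 /letter_lt; rewrite ltnNge k3.
  have : low_word 3 w \in filter (closed_in 3 code3) (words 3).
    rewrite mem_filter low_word_size andbT; apply/allP => p pu; case: ifP => // c3.
    have [yw lowy _] := put_in (leqnn 3) xw pu.
    rewrite nth_mkseq // -[code3 p]/(val (Ordinal c3)) letter_ord.
    by apply/eqP/(w_closed _ _ yw)/eqP; rewrite insub_eq_Some lowy.
  move/(allP code3_single_check) => /orP[fullu|single].
    by left; apply: low_word_full fullu => k k3 /(leq_ltn_trans k3); rewrite ltnn.
  right; apply: (block_of_single _ xw high _ single) => // y i _ _.
  by rewrite insub_eq_Some ltn_ord.
- by move=> x; rewrite insub_eq_None; have /andP[_ /eqP->] := low_check x.
- by move=> x; rewrite !bit_flip //= addbT addbF addNb.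
- by move=> x; rewrite !bit_flip //= !addbF.
- by move=> x; rewrite !bit_flip //= !addbF.
- by move=> x; rewrite !bit_flip //= addbT addbF addbN.
Qed.

(** * Length at least five *)

Lemma eq_find_upto (T : Type) (x0 : T) (a b : pred T) (s : seq T) :
  (forall i, i <= find a s -> i < size s -> a (nth x0 s i) = b (nth x0 s i)) ->
  find b s = find a s.
Proof.
elim: s => [//|x s IHs] ab /=; have /= abx := ab 0 isT isT; rewrite -abx.
case ax: (a x) => //; congr _.+1; apply: IHs => i ia is_.
by apply: (ab i.+1) => //=; rewrite ax.
Qed.

Section LongWords.

Variable n : nat.
Hypothesis n_ge5 : 5 <= n.
Implicit Types (x y : point n) (w : word n).

Definition parity x : bool := \big[addb/false]_(j < n | 5 <= j) x j.

(** The search stops at position n - 3 and returns n - 7 on failure. For n >= 7 this yields the last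
    bit n - 1 both when the first 1 is at n - 2 and when no earlier bit is 1. *)
Definition gray x : nat := 6 + find (bit x) (iota 5 (n - 7)).

Definition svar x : bool := parity x (+) bit x 5.

Definition gvar x : bool := parity x (+) bit x (gray x).

Definition level : nat := minn 2 (n - 5).

Definition local_code x : seq bool -> nat := code level (parity x) (svar x) (gvar x).

(** The value [n] encodes an unmatched point, since [insub] rejects it. *)
Definition direction x : nat :=
  let c := local_code x (low 5 x) in if c < 6 then c else if c == 6 then gray x else n.

Definition mate x : option 'I_n := insub (direction x).

(** * Effect of bit flips on parity, Gray position and local code *)

Lemma parity_flip x k : k < n -> parity (flip x k) = parity x (+) (5 <= k).
Proof.
move=> kn; rewrite /parity.
under eq_bigr do rewrite ffunE.
rewrite big_split /=; congr (_ (+) _).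
rewrite big_mkcond (bigD1 (Ordinal kn)) //= big1 ?addbF; last first.
  by move=> j; rewrite -val_eqE /= => /negbTE->; case: ifP.
by rewrite eqxx; case: ifP.
Qed.

Lemma gray_le x y : (forall k, 5 <= k -> k < gray x -> bit x k = bit y k) -> gray y = gray x.
Proof.
move=> xy; congr (6 + _); apply: (@eq_find_upto _ 0) => i iF; rewrite size_iota => isz.
by rewrite !nth_iota //; apply: xy; rewrite ?leq_addr // /gray ltnS -addnS; lia.
Qed.

(** The search reads only positions below its result; hence the Gray-code step keeps its own
    position and is an involution. *)
Lemma gray_flip x k : gray x <= k -> k < n -> gray (flip x k) = gray x.
Proof.
move=> xk kn; apply: gray_le => j _ jx.
by rewrite bit_flip // ltn_eqF ?addbF // (leq_trans jx).
Qed.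

Lemma gray_ge6 x : 6 <= gray x.
Proof. exact: leq_addr. Qed.

Lemma gray_lt x : 7 <= n -> gray x < n.
Proof. by move=> n7; have := find_size (bit x) (iota 5 (n - 7)); rewrite size_iota /gray; lia. Qed.

Lemma gray_eq x k : 6 <= k -> k < n ->
  (forall j, 5 <= j -> j.+1 < k -> bit x j = false) -> bit x k.-1 -> gray x = k.
Proof.
move=> k6 kn zeros one; rewrite /gray.
have sub : forall i, i < k - 6 -> bit x (nth 0 (iota 5 (n - 7)) i) = false.
  by move=> i ik; rewrite nth_iota; [apply: zeros; lia | lia].
suff -> : find (bit x) (iota 5 (n - 7)) = k - 6 by lia.
(* An earlier hit would be at a zero bit; a later one would pass over the 1 at [k.-1]. For k = n - 1
   the value is that of a failed search. *)
have [lt|gt|//] := ltngtP (find (bit x) (iota 5 (n - 7))) (k - 6).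
  have := sub _ lt; rewrite nth_find // has_find size_iota; lia.
have := @before_find _ 0 (bit x) (iota 5 (n - 7)) _ gt.
have := find_size (bit x) (iota 5 (n - 7)); rewrite size_iota => le.
rewrite nth_iota; last by lia.
by have -> : 5 + (k - 6) = k.-1 by [lia]; rewrite one.
Qed.

Lemma local_code_high x y : (forall k, 5 <= k -> bit y k = bit x k) ->
  gray y = gray x /\ local_code y = local_code x.
Proof.
move=> yx; have gyx : gray y = gray x by apply: gray_le => k k5 _; rewrite yx.
split=> //; have pyx : parity y = parity x.
  by apply: eq_bigr => j j5; rewrite -!bit_ord yx.
by rewrite /local_code /svar /gvar gyx pyx !yx // (leq_trans _ (gray_ge6 x)).
Qed.

Lemma local_code_flip_low x k : k < 5 ->
  gray (flip x k) = gray x /\ local_code (flip x k) = local_code x.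
Proof.
move=> k5; apply: local_code_high => j j5.
by rewrite bit_flip ?(leq_trans k5) // gtn_eqF ?addbF // (leq_trans k5).
Qed.

Lemma level_in : level \in [:: 0; 1; 2].
Proof. by rewrite !inE /level; lia. Qed.

Lemma level_gt0 : (0 < level) = (5 < n).
Proof. by rewrite /level; lia. Qed.

Lemma level_gt1 : (1 < level) = (6 < n).
Proof. by rewrite /level; lia. Qed.

Lemma local_involution b s g p : p \in points_of (nseq 5 None) ->
  let c := code level b s g p in
  [|| (c < 5) && (code level b s g (toggle c p) == c),
      [&& c == 5, 0 < level & all (fun g' => code level (~~ b) s g' p == 5) bools],
      [&& c == 6, 1 < level & code level (~~ b) (~~ s) g p == 6] | c == 7].
Proof.
move=> p5.
exact: (all_at (all_at (all_at (all_at (all_at involution_check level_in)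
  (mem_bools b)) (mem_bools s)) (mem_bools g)) p5).
Qed.

(** Parity and bit 5 change together, which keeps [svar]; the Gray position may move, so [g] is only
    asserted to exist. *)
Lemma local_code5_flip x : 5 < n ->
  exists g, local_code (flip x 5) = code level (~~ parity x) (svar x) g.
Proof.
move=> n5; exists (gvar (flip x 5)); rewrite /local_code /svar parity_flip // bit_flip //=.
by rewrite !addbT addbN addNb negbK.
Qed.

(** The Gray position stays and its bit changes with the parity, which keeps [gvar]; bit 5 is
    untouched, so [svar] is negated. *)
Lemma local_code6_flip x : 6 < n ->
  local_code (flip x (gray x)) = code level (~~ parity x) (~~ svar x) (gvar x).
Proof.
move=> n6; have gn := gray_lt x n6; have g6 := gray_ge6 x.
rewrite /local_code /gvar gray_flip // /svar parity_flip // !bit_flip //.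
rewrite (ltnW g6) eqxx (ltn_eqF g6) !addbT addbF addbN !addNb negbK //.
Qed.

Lemma mate_K x i : mate x = Some i -> mate (flip x i) = Some i.
Proof.
move/eqP; rewrite insub_eq_Some => /eqP ix; apply/eqP; rewrite insub_eq_Some.
have := local_involution (parity x) (svar x) (gvar x) (low_points 5 x).
rewrite -/(local_code x) => /or4P[].
- case/andP => c5 /eqP cK.
  have {}ix : i = local_code x (low 5 x) :> nat by rewrite ix /direction ltnW.
  have [gf lf] := @local_code_flip_low x i (leq_trans (eq_leq (congr1 S ix)) c5).
  by rewrite /direction lf low_flip // ix cK ltnW.
- case/and3P => /eqP c5 lev /allP h.
  have {}ix : i = 5 :> nat by rewrite ix /direction c5.
  rewrite level_gt0 in lev; have [g lf] := local_code5_flip x lev.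
  by rewrite /direction ix low_flip_high // lf (eqP (h g (mem_bools g))).
- case/and3P => /eqP c6 lev /eqP h.
  have {}ix : i = gray x :> nat by rewrite ix /direction c6.
  rewrite level_gt1 in lev; have gn := gray_lt x lev; have g6 := gray_ge6 x.
  by rewrite /direction ix low_flip_high ?(ltnW g6) // local_code6_flip // h gray_flip.
- by move/eqP => c7; move: (ltn_ord i); rewrite {1}ix /direction c7 ltnn.
Qed.

Lemma local_unmatched b s g p : p \in points_of (nseq 5 None) ->
  (code level b s g p == 7) =
  ~~ (nth false p 0 (+) nth false p 2 (+) nth false p 3 (+) nth false p 4) &&
  ~~ (nth false p 1 (+) nth false p 2 (+) nth false p 4 (+) b).
Proof.
move=> p5; apply: eqP.
exact: (all_at (all_at (all_at (all_at (all_at unmatched_check level_in)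
  (mem_bools b)) (mem_bools s)) (mem_bools g)) p5).
Qed.

Lemma mate_None x : (mate x == None) =
  ~~ (bit x 0 (+) bit x 2 (+) bit x 3 (+) bit x 4) &&
  ~~ (bit x 1 (+) bit x 2 (+) bit x 4 (+) parity x).
Proof.
have := local_unmatched (parity x) (svar x) (gvar x) (low_points 5 x).
rewrite !nth_mkseq // -/(local_code x) => <-.
have := local_involution (parity x) (svar x) (gvar x) (low_points 5 x).
rewrite -/(local_code x) insub_eq_None /direction => /or4P[].
- case/andP => c5 _; rewrite (leq_trans c5 _ : _ < 6) // [RHS]ltn_eqF ?(leq_trans c5) //.
  by rewrite leqNgt (leq_trans c5).
- by case/and3P => /eqP-> n5 _; rewrite /= leqNgt -level_gt0 n5.
- by case/and3P => /eqP->; rewrite level_gt1 => n6 _; rewrite /= leqNgt gray_lt.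
- by move/eqP->; rewrite leqnn.
Qed.

Lemma local_pair s g s' g' v : 5 < n -> v \in words 5 ->
  viable level false s g v -> viable level true s' g' v ->
  [|| full v,
      [&& all isSome v, s == s', all (fun p => code level false s g p == 5) (points_of v)
        & all (fun p => code level true s' g' p == 5) (points_of v)]
    | [&& all isSome v, g == g', all (fun p => code level false s g p == 6) (points_of v)
        & all (fun p => code level true s' g' p == 6) (points_of v)]].
Proof.
move=> n5 v5 vx; apply/implyP.
have lev : level \in [:: 1; 2] by rewrite !inE /level; lia.
have vf : v \in filter (viable level false s g) (words 5) by rewrite mem_filter vx.
exact: (all_at (all_at (all_at (all_at (all_at (all_at pair_check lev) (mem_bools s))
  (mem_bools g)) vf) (mem_bools s')) (mem_bools g')).
Qed.

Lemma local_full b s g : 5 < n ->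
  hits 5 (code level b s g) (nseq 5 None) &&
  ((1 < level) ==> hits 6 (code level b s g) (nseq 5 None)).
Proof.
move=> n5; have lev : level \in [:: 1; 2] by rewrite !inE /level; lia.
exact: (all_at (all_at (all_at (all_at full_check lev)
  (mem_bools b)) (mem_bools s)) (mem_bools g)).
Qed.

Lemma local_single b s g v : v \in words 5 -> closed_in 5 (code level b s g) v ->
  [|| hits 5 (code level b s g) v && (0 < level), hits 6 (code level b s g) v && (1 < level),
      full v && (level == 0) | single_block 5 (code level b s g) v].
Proof.
move=> v5 vc; have vf : v \in filter (closed_in 5 (code level b s g)) (words 5).
  by rewrite mem_filter vc.
exact: (all_at (all_at (all_at (all_at (all_at single_check level_in)
  (mem_bools b)) (mem_bools s)) (mem_bools g)) vf).
Qed.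

(** * Subcubes left by no matching edge *)

Section ClosedWord.

Variable w : word n.
Hypothesis w_closed : mu_closed mate w.

Let u := low_word 5 w.

Lemma direction_free x : x \in subcube w -> direction x < n -> letter w (direction x) = None.
Proof.
move=> xw dn; rewrite -[direction x]/(val (Ordinal dn)) letter_ord.
by apply: (w_closed xw); apply/eqP; rewrite insub_eq_Some.
Qed.

(** Local code and Gray position depend on z alone, so any low part allowed by [u] can be placed
    over the z of [x]. *)
Lemma lift_low x p : x \in subcube w -> p \in points_of u ->
  exists y, [/\ y \in subcube w, low 5 y = p, gray y = gray x & local_code y = local_code x].
Proof.
move=> xw pu; have [yw lowy bity] := put_in n_ge5 xw pu.
by have [? ?] := local_code_high bity; exists (put p x).
Qed.

Lemma closed_at x : x \in subcube w -> closed_in 5 (local_code x) u.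
Proof.
move=> xw; apply/allP => p pu; case: ifP => // c5.
have [y [yw lowy _ cy]] := lift_low xw pu.
have dy : direction y = local_code x p by rewrite /direction cy lowy ltnW.
by rewrite nth_mkseq // -dy direction_free // dy (leq_trans c5).
Qed.

Lemma hits5_free x : x \in subcube w -> hits 5 (local_code x) u -> 5 < n /\ letter w 5 = None.
Proof.
move=> xw /hasP[p pu /eqP c5]; have [y [yw lowy _ cy]] := lift_low xw pu.
have := local_involution (parity y) (svar y) (gvar y) (low_points 5 y).
rewrite -/(local_code y) cy lowy c5 /= level_gt0 orbF => /andP[n5 _].
have dy : direction y = 5 by rewrite /direction cy lowy c5.
by split=> //; rewrite -dy direction_free // dy.
Qed.

Lemma hits6_free x : x \in subcube w -> hits 6 (local_code x) u ->
  6 < n /\ letter w (gray x) = None.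
Proof.
move=> xw /hasP[p pu /eqP c6]; have [y [yw lowy gy cy]] := lift_low xw pu.
have := local_involution (parity y) (svar y) (gvar y) (low_points 5 y).
rewrite -/(local_code y) cy lowy c6 /= level_gt1 orbF => /andP[n6 _].
have dy : direction y = gray x by rewrite /direction cy lowy c6 gy.
by split=> //; rewrite -dy direction_free // dy gray_lt.
Qed.

Lemma viable_at x : x \in subcube w -> viable level (parity x) (svar x) (gvar x) u.
Proof.
move=> xw; apply/and3P; rewrite -/(local_code x); split.
- exact: closed_at.
- apply/implyP => /(hits5_free xw)[n5 w5]; have [g cg] := local_code5_flip x n5.
  apply/hasP; exists g; first exact: mem_bools.
  by rewrite -cg closed_at // flip_letter.
- apply/implyP => /(hits6_free xw)[n6 wg].
  by rewrite -local_code6_flip // closed_at // flip_letter.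
Qed.

Lemma pair_at x y : x \in subcube w -> y \in subcube w -> parity y = ~~ parity x -> 5 < n ->
  [\/ full u,
      [/\ all isSome u, svar x = svar y, local_code x (low 5 x) = 5
        & local_code y (low 5 y) = 5]
    | [/\ all isSome u, gvar x = gvar y, local_code x (low 5 x) = 6
        & local_code y (low 5 y) = 6]].
Proof.
(* The finite check puts the even layer first; the conclusion is symmetric in [x] and [y]. *)
wlog px : x y / parity x = false.
  move=> wl xw yw pxy n5; case px: (parity x) pxy => pxy; last by apply: wl; rewrite ?px.
  have := wl y x; rewrite px pxy => /(_ erefl yw xw erefl n5)[fu|[su sg c c']|[su sg c c']].
  - exact: Or31.
  - exact: Or32.
  - exact: Or33.
move=> xw yw py n5; rewrite px in py.
have vx := viable_at xw; have vy := viable_at yw; rewrite px in vx; rewrite py in vy.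
rewrite /local_code px py.
case/or3P: (local_pair n5 (low_word_size 5 w) vx vy); first exact: Or31.
- case/and4P => su /eqP sv cx cy; apply: Or32; split=> //; apply/eqP.
    exact: (all_at cx (low_in 5 xw)).
  exact: (all_at cy (low_in 5 yw)).
- case/and4P => su /eqP sv cx cy; apply: Or33; split=> //; apply/eqP.
    exact: (all_at cx (low_in 5 xw)).
  exact: (all_at cy (low_in 5 yw)).
Qed.

Lemma block_of_one_free x k : x \in subcube w -> all isSome u -> letter w k = None ->
  (forall j, letter w j = None -> 5 <= j -> j = k) -> direction x = k -> w \in blocks mate.
Proof.
move=> xw /allP su wk only dx.
have low_some j : j < 5 -> letter w j <> None.
  move=> j5; have : nth None u j \in u by rewrite mem_nth // size_mkseq.
  by move/su; rewrite nth_mkseq //; case: (letter w j).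
apply/imsetP; exists x => //; apply/ffunP => i; rewrite ffunE insub_eq_Some dx -letter_ord.
have [->|ik] := eqVneq (i : nat) k; first by rewrite wk.
have /mem_letters/(_ i)[wi|->] := xw; last by rewrite bit_ord.
by have [/low_some|/(only _ wi)/eqP] := ltnP i 5; rewrite ?(negbTE ik).
Qed.

(** A full layer contains vertical edges of both kinds: they free letter 5, then the later letters
    in increasing order. *)
Lemma all_free : 5 < n -> full u -> forall i, w i = None.
Proof.
move=> n5 fu; have [x0 x0w] := subcube_nonempty w.
have uE : u = nseq 5 None.
  by apply/all_pred1P: fu; rewrite size_mkseq.
have hit x : x \in subcube w -> letter w 5 = None /\ (6 < n -> letter w (gray x) = None).
  move=> xw; have := local_full (parity x) (svar x) (gvar x) n5.
  rewrite -uE -/(local_code x) => /andP[/(hits5_free xw)[_ w5] /implyP h6].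
  by split=> // n6; have /h6/(hits6_free xw)[] : 1 < level by rewrite level_gt1.
suff all_letters k : k < n -> letter w k = None by move=> i; rewrite -letter_ord all_letters.
elim/ltn_ind: k => k IHk kn; have [k5|k5|->] := ltngtP k 5; last by have [] := hit _ x0w.
  have /allP/(_ (letter w k)) := fu; rewrite -(nth_mkseq None (letter w) k5) => h.
  by apply/eqP/h/mem_nth; rewrite size_mkseq.
(* By induction the letters below [k] are free, so z may start with zeros followed by a 1 at [k.-1];
   its Gray position is then [k]. *)
pose x : point n := [ffun j : 'I_n => if (5 <= j < k) then j.+1 == k else x0 j].
have bitx j : j < n -> bit x j = if 5 <= j < k then j.+1 == k else bit x0 j.
  by move=> jn; rewrite -[j]/(val (Ordinal jn)) !bit_ord ffunE.
have xw : x \in subcube w.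
  apply/mem_subcube => j; rewrite ffunE; case: ifP => [/andP[_ jk]|_].
    by left; rewrite -letter_ord IHk.
  exact: (mem_subcube _ _ x0w).
suff <- : gray x = k by have [_] := hit _ xw; apply; apply: leq_ltn_trans kn.
clear IHk; move: (x) bitx => y bity.
apply: gray_eq => // [j j5 jk|].
  have [jn jk'] : j < n /\ j < k by lia.
  by rewrite bity // j5 jk' ltn_eqF.
have [kn' kk] : k.-1 < n /\ 5 <= k.-1 < k by lia.
by rewrite bity // kk prednK //; lia.
Qed.

(** A free letter of z gives two points of opposite parity, to which [pair_at] applies; without one,
    [w] lies in a single layer. *)
Lemma closed_word : (forall i, w i = None) \/ w \in blocks mate.
Proof.
have [x xw] := subcube_nonempty w.
have [/hasP[j]|none] := boolP (has (fun j => letter w j == None) (iota 5 (n - 5))).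
  rewrite mem_iota => /andP[j5 _] /eqP wj; have jn := letter_lt wj.
  have n5 : 5 < n by apply: leq_ltn_trans jn.
  have neighbour y k : y \in subcube w -> letter w k = None -> 5 <= k ->
      flip y k \in subcube w /\ parity (flip y k) = ~~ parity y.
    by move=> yw wk k5; rewrite flip_letter // parity_flip ?(letter_lt wk) // k5 addbT.
  have [fu|nfu] := boolP (full u); first by left; apply: all_free.
  right; have [yw py] := neighbour x j xw wj j5.
  case: (pair_at xw yw py n5) => [fu|[su _ cx _]|[su _ cx _]]; first by rewrite fu in nfu.
  + have dx : direction x = 5 by rewrite /direction cx.
    (* Flipping any free [k] changes the parity but must keep [svar], so it has to change bit 5. *)
    have only k : letter w k = None -> 5 <= k -> k = 5.
      move=> wk k5; have [zw pz] := neighbour x k xw wk k5.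
      case: (pair_at xw zw pz n5) => [fu|[_ sv _ _]|[_ _ c6 _]];
        [by rewrite fu in nfu | move: sv | by rewrite cx in c6].
      rewrite /svar pz bit_flip ?(letter_lt wk) // addNb -addbN.
      by case: eqP => [<-|_]; rewrite ?addbF // => /addbI; case: (bit x 5).
    by apply: (block_of_one_free (x := x) xw su _ only dx); rewrite -dx direction_free // dx.
  + have six z k : z \in subcube w -> local_code z (low 5 z) = 6 -> letter w k = None -> 5 <= k ->
        [/\ letter w (gray z) = None, flip z k \in subcube w,
            local_code (flip z k) (low 5 (flip z k)) = 6
          & bit (flip z k) (gray (flip z k)) = ~~ bit z (gray z)].
      move=> zw cz wk k5; have [yw' py'] := neighbour z k zw wk k5.
      case: (pair_at zw yw' py' n5) => [fu|[_ _ c5 _]|[_ gz _ cy]];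
        [by rewrite fu in nfu | by rewrite cz in c5 | move: gz].
      rewrite /gvar py' addNb -addbN => /addbI gz.
      have [_ wg] : 6 < n /\ letter w (gray z) = None.
        by apply: hits6_free => //; apply/hasP; exists (low 5 z); rewrite ?low_in ?cz.
      by split=> //; rewrite gz negbK.
    (* A flip beyond the Gray position changes neither that position nor its bit, contrary to
       [six]. *)
    have le_gray z k : z \in subcube w -> local_code z (low 5 z) = 6 -> letter w k = None ->
        5 <= k -> k <= gray z.
      move=> zw cz wk k5; rewrite leqNgt; apply/negP => gk.
      have [_ _ _] := six z k zw cz wk k5; have kn := letter_lt wk.
      by rewrite gray_flip ?(ltnW gk) // bit_flip // ltn_eqF // addbF; case: bit.
    have dx : direction x = gray x by rewrite /direction cx.
    have [wg _ _ _] := six x j xw cx wj j5.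
    apply: (block_of_one_free (x := x) xw su wg _ dx) => k wk k5.
    have [_ zw cz] := six x k xw cx wk k5.
    have [wgz _ _ _] := six _ k zw cz wk k5.
    (* Both Gray positions are free letters, so [le_gray] at each of the two points bounds one
       position by the other. *)
    have -> : gray (flip x k) = gray x.
      by apply/eqP; rewrite eqn_leq; apply/andP; split; apply: le_gray => //; apply: ltnW (gray_ge6 _).
    (* The bit at the common Gray position must change, so [k] is that position. *)
    rewrite bit_flip ?(letter_lt wk) //.
    by case: eqP => [//|_]; rewrite addbF; case: bit.
have high k : 5 <= k -> letter w k <> None.
  move=> k5 wk; have /negP[] := none; apply/hasP; exists k; last by rewrite wk.
  by rewrite mem_iota k5 subnKC // (letter_lt wk).
have := local_single (low_word_size 5 w) (closed_at xw).
rewrite -/(local_code x); case/or4P => [/andP[h _]|/andP[h _]|/andP[fu /eqP lev]|single].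
- by have [_ /high] := hits5_free xw h; case.
- by have [_ /high] := hits6_free xw h; case; apply: ltnW (gray_ge6 x).
- left; apply: low_word_full fu => k k5 kn; move: lev; rewrite /level; lia.
right; apply: (block_of_single _ xw high _ single) => // y i yw yx.
have [_ cy] := local_code_high yx; rewrite insub_eq_Some.
have := local_involution (parity y) (svar y) (gvar y) (low_points 5 y).
rewrite -/(local_code y) cy => /or4P[].
- by case/andP => c5 _; rewrite /direction cy ltnW // andbC; case: eqP => // ->.
- case/andP => /eqP c5 _; have [_ /high] : 5 < n /\ letter w 5 = None; last by case.
  by apply: (hits5_free xw); apply/hasP; exists (low 5 y); rewrite ?low_in ?c5.
- case/andP => /eqP c6 _; have [_ /high] : 6 < n /\ letter w (gray x) = None.
    by apply: (hits6_free xw); apply/hasP; exists (low 5 y); rewrite ?low_in ?c6.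
  by case; apply: ltnW (gray_ge6 x).
- move=> /eqP c7; rewrite /direction cy c7 /= ltn_eqF //.
  by case: ltnP => //= i5; rewrite ltn_eqF // (leq_trans i5).
Qed.

End ClosedWord.

Lemma partition_long :
  exists F : {set word n},
    [/\ subcube_partition F, tight F, irreducible F & #|F| = 5 * 2 ^ (n - 3)].
Proof.
have low_lt k : k < 5 -> k < n by move=> k5; apply: leq_trans n_ge5.
(* Coordinate 0 occurs only in the first equation and coordinate 1 only in the second; [parity]
   ignores both. *)
apply: (@partition_of_matching _ mate mate_K
  (fun x => bit x 0 (+) bit x 2 (+) bit x 3 (+) bit x 4)
  (fun x => bit x 1 (+) bit x 2 (+) bit x 4 (+) parity x) 0 1).
- exact: low_lt.
- exact: closed_word.
- exact: mate_None.
- by move=> x; rewrite !bit_flip ?low_lt //= !addbF addbT !addNb.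
- by move=> x; rewrite !bit_flip ?parity_flip ?low_lt //= !addbF.
- by move=> x; rewrite !bit_flip ?low_lt //= !addbF.
- by move=> x; rewrite !bit_flip ?parity_flip ?low_lt //= !addbF addbT !addNb.
Qed.

End LongWords.

Theorem theorem2p42 (n : nat) (n_ge3 : 3 <= n) (n_neq4 : n <> 4) :
  exists F : {set word n},
    [/\ subcube_partition F, tight F, irreducible F & #|F| = 5 * 2 ^ (n - 3)].
Proof.
have [n5|] := leqP 5 n; first exact: partition_long.
case: n n_ge3 n_neq4 => [|[|[|[|[|n]]]]] // _ _ _; exact: partition3.
Qed.
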